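(* Suppose that there exists a pseudo-$P_{\mathfrak b^+}$-point. Then $\mathrm{cf}^\ast(\mathrm{Sym}(\omega))=\mathfrak b$.
   Context: $\mathfrak b$ is the bounding number (the minimal size of a $\leq^\ast$-unbounded subset of $\omega^\omega$) and $\mathfrak b^+$ its successor cardinal. All filters are assumed non-principal. For a cardinal $\kappa$, an ultrafilter $\mathcal L$ on $\omega$ is a pseudo-$P_\kappa$-point if for every $\mathcal L'\subset\mathcal L$ with $|\mathcal L'|<\kappa$ there is an infinite $L\subset\omega$ such that $L\subset^\ast L'$ (i.e. $L\setminus L'$ is finite) for all $L'\in\mathcal L'$. $\mathrm{Sym}(\omega)$ is the group of all permutations of $\omega$. For $x,y\in\omega^\omega$, $x\leq^\ast y$ means $x(n)\leq y(n)$ for all but finitely many $n$. For an increasing function $f\in\omega^\omega$, $S_f$ is the subgroup of $\mathrm{Sym}(\omega)$ generated by $\{\pi\in\mathrm{Sym}(\omega):\pi,\pi^{-1}\leq^\ast f\}$. $\mathrm{cf}^\ast(\mathrm{Sym}(\omega))$ is the minimal length $\lambda$ of an increasing (with respect to inclusion) chain $\langle G_i:i<\lambda\rangle$ of proper subgroups of $\mathrm{Sym}(\omega)$ with $\bigcup_{i<\lambda}G_i=\mathrm{Sym}(\omega)$ such that for every increasing $f\in\omega^\omega$ there is $i<\lambda$ with $S_f\subset G_i$. *)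

(* Defs.v *)
From HB Require Import structures.
From mathcomp Require Import all_boot all_order all_classical.
From mathcomp Require wochoice.

Set Implicit Arguments.
Unset Strict Implicit.
Unset Printing Implicit Defensive.

Local Open Scope classical_set_scope.
Local Open Scope card_scope.
Local Open Scope group_scope.

(* An ordinal is represented by any well-ordered type of that order type, so
   ordinals are only determined up to order isomorphism, and "x = alpha" is
   rendered by a predicate on representatives. *)
Record ordinal_rep := OrdinalRep {
  ord_sort :> Type;
  ord_le : rel ord_sort;
  ord_wo : wochoice.well_order ord_le
}.

Definition ord_lt (a : ordinal_rep) (x y : a) : bool :=
  ord_le x y && (x != y :> {classic a}).

(* [a] is isomorphic to an initial segment of [b] *)
Definition ordinal_le (a b : ordinal_rep) : Prop :=
  exists f : a -> b,
    (forall x y, ord_le (f x) (f y) = ord_le x y) /\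
    (forall x z, ord_le z (f x) -> exists y, f y = z).

Definition card_lt {T U : Type} (A : set T) (B : set U) : bool :=
  (A #<= B) && ~~ (B #<= A).

(* cardinals are initial ordinals *)
Definition is_cardinal (k : ordinal_rep) : Prop :=
  forall x : k, card_lt [set y | ord_lt y x] [set: k].

Definition is_successor_cardinal (k kplus : ordinal_rep) : Prop :=
  [/\ is_cardinal kplus,
      card_lt [set: k] [set: kplus] &
      forall mu : ordinal_rep, is_cardinal mu ->
        card_lt [set: k] [set: mu] -> ordinal_le kplus mu].

Definition le_star (x y : nat -> nat) : Prop :=
  finite_set [set n | ~ (x n <= y n)%N].

Definition unbounded_star (F : set (nat -> nat)) : Prop :=
  ~ exists g : nat -> nat, forall f, F f -> le_star f g.

Definition is_bounding_number (b : ordinal_rep) : Prop :=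
  [/\ is_cardinal b,
      exists F : set (nat -> nat), unbounded_star F /\ F #= [set: b] &
      forall F : set (nat -> nat), unbounded_star F -> [set: b] #<= F].

Definition almost_subset (A B : set nat) : Prop := finite_set (A `\` B).

(* [globally A] is the principal filter of all supersets of [A] *)
Definition non_principal (F : set_system nat) : Prop :=
  forall A : set nat, F <> globally A.

Definition pseudo_P_point (k : ordinal_rep) (L : set_system nat) : Prop :=
  [/\ UltraFilter L, non_principal L &
      forall L' : set_system nat, L' `<=` L -> card_lt L' [set: k] ->
        exists A : set nat, infinite_set A /\
          forall B, L' B -> almost_subset A B].

Record sym_nat := SymNat {
  sym_fun :> nat -> nat;
  sym_bij : `[< bijective sym_fun >]
}.

HB.instance Definition _ := [isSub for sym_fun].
HB.instance Definition _ := [Choice of sym_nat by <:].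

Fact sym_one_subproof : `[< bijective (@id nat) >].
Proof. by apply/asboolP; exists id. Qed.

Fact sym_mul_subproof (p q : sym_nat) : `[< bijective (p \o q) >].
Proof. by apply/asboolP/bij_comp; apply/asboolP/sym_bij. Qed.

Fact sym_inv_exists (p : sym_nat) :
  exists g : nat -> nat, cancel p g /\ cancel g p.
Proof. by have /asboolP[g pK gK] := sym_bij p; exists g. Qed.

Definition sym_inv_fun (p : sym_nat) : nat -> nat := sval (cid (sym_inv_exists p)).

Fact sym_inv_funK (p : sym_nat) : cancel p (sym_inv_fun p).
Proof. by rewrite /sym_inv_fun; case: cid => g []. Qed.

Fact sym_funK (p : sym_nat) : cancel (sym_inv_fun p) p.
Proof. by rewrite /sym_inv_fun; case: cid => g []. Qed.

Fact sym_inv_subproof (p : sym_nat) : `[< bijective (sym_inv_fun p) >].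
Proof.
by apply/asboolP; exists p; [exact: sym_funK | exact: sym_inv_funK].
Qed.

Definition sym_one := SymNat sym_one_subproof.
Definition sym_mul (p q : sym_nat) := SymNat (sym_mul_subproof p q).
Definition sym_inv (p : sym_nat) := SymNat (sym_inv_subproof p).

Fact sym_mulA : associative sym_mul.
Proof. by move=> p q r; apply: val_inj. Qed.

Fact sym_mul1 : left_id sym_one sym_mul.
Proof. by move=> p; apply: val_inj. Qed.

Fact sym_mulr1 : right_id sym_one sym_mul.
Proof. by move=> p; apply: val_inj. Qed.

Fact sym_mulV : left_inverse sym_one sym_inv sym_mul.
Proof. by move=> p; apply: val_inj; apply/funext => n; apply: sym_inv_funK. Qed.

Fact sym_mulrV : right_inverse sym_one sym_inv sym_mul.
Proof. by move=> p; apply: val_inj; apply/funext => n; apply: sym_funK. Qed.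

HB.instance Definition _ :=
  isGroup.Build sym_nat sym_mulA sym_mul1 sym_mulr1 sym_mulV sym_mulrV.

Definition is_subgroup (H : set sym_nat) : Prop := group_closed (mem H).

(* Every nondecreasing function is below a strictly increasing one, and [S_]
   is monotone, so strictness does not affect [cf_star_chain]. *)
Definition increasing (f : nat -> nat) : Prop := {homo f : m n / (m < n)%N}.

Definition S_ (f : nat -> nat) : set sym_nat :=
  smallest is_subgroup [set p : sym_nat | le_star p f /\ le_star (p^-1)%g f].

(* Chains are increasing in the weak sense: repetitions are allowed. Deleting
   them from a chain never increases its order type, so the least length is
   the same as for strictly increasing chains. *)
Definition cf_star_chain (a : ordinal_rep) (G : a -> set sym_nat) : Prop :=
  [/\ forall i, is_subgroup (G i) /\ G i <> [set: sym_nat],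
      forall i j, ord_le i j -> G i `<=` G j,
      \bigcup_i G i = [set: sym_nat] &
      forall f, increasing f -> exists i, S_ f `<=` G i].

Definition is_cf_star (a : ordinal_rep) : Prop :=
  (exists G : a -> set sym_nat, cf_star_chain G) /\
  (forall (c : ordinal_rep) (G : c -> set sym_nat),
     cf_star_chain G -> ordinal_le a c).

(* Main.v *)
Require Import Defs.
From mathcomp Require Import all_boot all_order all_classical.
From mathcomp Require wochoice.

Set Implicit Arguments.
Unset Strict Implicit.
Unset Printing Implicit Defensive.

Local Open Scope classical_set_scope.
Local Open Scope card_scope.

(** For a chain of length [b], take an unbounded family [x] of increasing
    functions indexed by [b], and a pseudo-P-point [L].  Call a permutation [p]
    bounded by a function [f] modulo [L] when, for [L]-many [n], both [p] and
    its inverse map the interval [[0, n]] into [[0, f n]].  Let [G i] be the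
    subgroup generated by the permutations bounded modulo [L] by some [x j]
    with [j] at most [i].  Its properties rest on one remark: an infinite set
    [A] turns a bound on [A] of a monotone quantity into a bound everywhere, by
    passing from [n] to a point of [A] above it.

    - The [G i] cover the group and absorb the [S_ f], because every [f] is
      below some [x i] on a set of [L] ([dominating_mod_ultrafilter]).
      Otherwise every [x i] would be below [f] on a set of [L]; an infinite
      pseudo-intersection [A] of these sets would give a single bound for the
      whole family [x].

    - Each [G i] is proper.  Fewer than [b] functions [x j] occur in it, so they
      are dominated by one function [z], and it is enough that the permutations
      bounded by [z] modulo [L] generate a proper subgroup
      ([bounded_mod_proper]).  If they generated all permutations, each member
      of an unbounded family of permutations indexed by [b] would be a product
      of such generators, and a pseudo-intersection [A] of the sets of [L]
      involved would put the whole family in a single [S_ y], with [y]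
      depending only on [A] and [z].  But the elements of [S_ y] have a common
      bound ([S_bounded]).

    No shorter chain exists: if [b] does not embed in [c] as an initial segment,
    then [c] has fewer than [b] elements ([initial_segment_embedding]).  Given a
    chain indexed by [c], choose a permutation outside each of its members; a
    single [f] dominates all these permutations and their inverses, so that
    [S_ f] lies in no member of the chain. *)

(** * Eventual domination *)

Lemma cofinite_natP (P : nat -> Prop) :
  finite_set [set n | ~ P n] <-> exists N, forall n, (N <= n)%N -> P n.
Proof.
split=> [/finite_seqP[s Es]|[N PN]].
  exists (\max_(i <- s) i).+1 => n ltn; apply: contrapT => nPn.
  have : [set` s] n by rewrite -Es.
  move=> /= ns; have := @leq_bigmax_seq _ s xpredT id n ns isT.
  by rewrite leqNgt ltn.
apply: (@sub_finite_set _ _ `I_N) => [n nPn|]; last exact: finite_II.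
by rewrite /= ltnNge; apply/negP => /PN.
Qed.

Lemma le_starP x y :
  le_star x y <-> exists N, forall n, (N <= n)%N -> (x n <= y n)%N.
Proof. exact: cofinite_natP. Qed.

Lemma almost_subsetP A B :
  almost_subset A B <-> exists N, forall n, (N <= n)%N -> A n -> B n.
Proof.
rewrite -cofinite_natP /almost_subset.
suff -> : A `\` B = [set n | ~ (A n -> B n)] by [].
by rewrite predeqE => n /=; rewrite not_implyE.
Qed.

Lemma le_star_trans y x z : le_star x y -> le_star y z -> le_star x z.
Proof.
move=> /le_starP[M xy] /le_starP[N yz]; apply/le_starP; exists (maxn M N) => n.
by rewrite geq_max => /andP[/xy xyn /yz]; apply: leq_trans.
Qed.

Lemma infinite_ge (A : set nat) (n : nat) :
  infinite_set A -> exists m, A m /\ (n <= m)%N.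
Proof.
move=> Ainf; apply: contrapT => noA; apply: Ainf.
apply: (@sub_finite_set _ _ `I_n) => [m Am|]; last exact: finite_II.
by rewrite /= ltnNge; apply/negP => le_nm; apply: noA; exists m.
Qed.

(** A strictly increasing function pointwise at least [g]. *)
Fixpoint majorant (g : nat -> nat) n : nat :=
  if n is m.+1 then (majorant g m + g m.+1).+1 else g 0.

Lemma le_majorant g n : (g n <= majorant g n)%N.
Proof. by case: n => [|n] //=; apply/leqW/leq_addl. Qed.

Lemma majorant_increasing g : increasing (majorant g).
Proof.
apply: homo_ltn => [y x z|n]; first exact: ltn_trans.
by rewrite /= ltnS leq_addr.
Qed.

Lemma increasing_le f m n : increasing f -> (m <= n)%N -> (f m <= f n)%N.
Proof. by move=> finc; apply: (ltnW_homo finc). Qed.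

Lemma increasing_ge f n : increasing f -> (n <= f n)%N.
Proof.
by move=> finc; elim: n => // n IHn; apply: leq_ltn_trans IHn (finc _ _ _).
Qed.

(** * The subgroups generated by bounded permutations *)

Lemma is_subgroupP (H : set sym_nat) :
  is_subgroup H <-> H 1%g /\ forall p q, H p -> H q -> H (p * q^-1)%g.
Proof.
split=> [[/set_mem H1 HV]|[H1 HV]]; split=> //.
- by move=> p q /mem_set Hp /mem_set Hq; apply/set_mem/HV.
- exact: mem_set.
- by move=> p q /set_mem Hp /set_mem Hq; apply/mem_set/HV.
Qed.

Lemma is_subgroup_smallest (P : set sym_nat) :
  is_subgroup (smallest is_subgroup P).
Proof.
apply/is_subgroupP; split=> [H [/is_subgroupP[] //]|p q Hp Hq H HP].
have /is_subgroupP[_] := HP.1; apply; [exact: Hp|exact: Hq].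
Qed.

(** A permutation tends to infinity. *)
Lemma sym_nat_tail (p : sym_nat) N :
  exists M, forall n, (M <= n)%N -> (N <= p n)%N.
Proof.
(* Only the images of [0, ..., N - 1] under the inverse can fail. *)
exists (\max_(k < N) ((p^-1)%g k)).+1 => n; apply: contraTT.
rewrite -!ltnNge ltnS => ltN.
by rewrite -[leqLHS](sym_inv_funK p n) (leq_bigmax (Ordinal ltN)).
Qed.

Lemma le_star_comp f g (p q : sym_nat) : increasing f ->
  le_star p f -> le_star q g -> le_star (p * q)%g (f \o g).
Proof.
move=> finc /le_starP[M pf] /le_starP[N qg]; apply/le_starP.
have [K qM] := sym_nat_tail q M; exists (maxn N K) => n.
rewrite geq_max => /andP[/qg qgn /qM /pf pfn].
exact: leq_trans pfn (increasing_le finc qgn).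
Qed.

Lemma S_sub_iter f (p : sym_nat) : increasing f -> S_ f p ->
  exists k, le_star p (iter k f) /\ le_star (p^-1)%g (iter k f).
Proof.
move=> finc; have iter_inc k : increasing (iter k f).
  by elim: k => //= k IHk m n ltmn; apply/finc/IHk.
pose H := [set q : sym_nat |
  exists k, le_star q (iter k f) /\ le_star (q^-1)%g (iter k f)].
apply: (@smallest_sub _ is_subgroup _ H) => [|q qf]; last by exists 1.
apply/is_subgroupP; split=> [|q r [k [qk qVk]] [l [rl rVl]]].
  by exists 0; rewrite invg1; split; apply/le_starP; exists 0.
have iterD i j : iter i f \o iter j f = iter (i + j) f.
  by apply/funext => n; rewrite /= iterD.
exists (k + l); split; first by rewrite -iterD; apply: le_star_comp.
by rewrite invgM invgK addnC -iterD; apply: le_star_comp.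
Qed.

(** All the elements of [S_ f] are dominated by one function. *)
Lemma S_bounded f : increasing f -> exists w, forall p, S_ f p -> le_star p w.
Proof.
move=> finc.
(* [iter n f n] is at least [iter k f n] as soon as [n] is at least [k]. *)
exists (fun n => iter n f n) => p /(S_sub_iter finc)[k [pk _]].
have iter_le i j n : (iter i f n <= iter (j + i) f n)%N.
  by elim: j => // j IHj; apply: leq_trans IHj (increasing_ge _ finc).
apply: le_star_trans pk _; apply/le_starP; exists k => n /subnK {2}<-.
exact: iter_le.
Qed.

(** * Unbounded families of permutations *)

(** The involution exchanging [2 n] with [2 (x n) + 1] for every [n] and fixing
    the remaining odd numbers; it is meant for injective [x]. *)
Definition swap_fun (x : nat -> nat) (m : nat) : nat :=
  if ~~ odd m then (x m./2).*2.+1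
  else if pselect (exists n, x n = m./2) is left h then (sval (cid h)).*2
  else m.

Lemma swap_fun_even x n : swap_fun x n.*2 = (x n).*2.+1.
Proof. by rewrite /swap_fun odd_double doubleK. Qed.

Lemma swap_fun_odd x n : injective x -> swap_fun x (x n).*2.+1 = n.*2.
Proof.
move=> xinj; rewrite /swap_fun oddS odd_double /= uphalf_double.
case: pselect => [h|[]]; last by exists n.
by case: cid => k /= /xinj ->.
Qed.

Lemma swap_funK x : injective x -> involutive (swap_fun x).
Proof.
move=> xinj m; case: (boolP (odd m)) => [oddm|evenm]; last first.
  by rewrite -(even_halfK (n := m)) // swap_fun_even swap_fun_odd.
have Em : m = m./2.*2.+1 by rewrite -[LHS]odd_double_half oddm.
have [[n xn]|nox] := pselect (exists n, x n = m./2).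
  by rewrite Em -xn swap_fun_odd // swap_fun_even.
suff Es : swap_fun x m = m by rewrite !Es.
by rewrite /swap_fun oddm /=; case: pselect.
Qed.

Lemma sym_nat_above x : increasing x ->
  exists p : sym_nat, forall n, (x n <= p n.*2)%N.
Proof.
move=> xinc; have xinj : injective x.
  move=> m n Emn; case: (ltngtP m n) => // /xinc; rewrite Emn ltnn //.
have bij : `[< bijective (swap_fun x) >].
  by apply/asboolP; exists (swap_fun x); apply: swap_funK.
exists (SymNat bij) => n; rewrite /= swap_fun_even.
by rewrite -addnn -addnS leq_addr.
Qed.

Lemma unbounded_sym_nat I (x : I -> nat -> nat) :
    (forall i, increasing (x i)) -> (~ exists g, forall i, le_star (x i) g) ->
  exists p : I -> sym_nat, ~ exists g, forall i, le_star (p i) g.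
Proof.
move=> xinc xunb; have [p xp] := choice (fun i => sym_nat_above (xinc i)).
exists p => -[g pg]; apply: xunb; exists (fun n => g n.*2) => i.
have /le_starP[N pN] := pg i; apply/le_starP; exists N => n leNn.
apply: leq_trans (xp i n) (pN _ _).
by rewrite -addnn (leq_trans leNn) ?leq_addr.
Qed.

(** * Families of functions and the bounding number *)

Lemma unbounded_family (b : ordinal_rep) : is_bounding_number b ->
  exists x : b -> nat -> nat,
    (forall i, increasing (x i)) /\ ~ exists g, forall i, le_star (x i) g.
Proof.
case=> _ [F [Funb]] + _; rewrite card_eq_le => /andP[/pcard_surjP[e eF] _].
exists (fun i => majorant (e i)); split=> [i|[g xg]].
  exact: majorant_increasing.
apply: Funb; exists g => f /eF[i _ <-]; apply: le_star_trans (xg i).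
by apply/le_starP; exists 0 => n _; apply: le_majorant.
Qed.

Lemma small_family_bounded (b : ordinal_rep) I (S : set I)
    (h : I -> nat -> nat) :
    is_bounding_number b -> ~ ([set: b] #<= S) ->
  exists2 g, increasing g & forall i, S i -> le_star (h i) g.
Proof.
case=> _ _ bmin Ssmall; apply: contrapT => nog; apply: Ssmall.
suff /bmin leb : unbounded_star (h @` S).
  exact: card_le_trans leb (card_image_le _ _).
case=> g hg; apply: nog; exists (majorant g) => [|i Si].
  exact: majorant_increasing.
apply: (@le_star_trans g); first by apply: hg; exists i.
by apply/le_starP; exists 0 => n _; apply: le_majorant.
Qed.

(** * Well-orders *)

Section WellOrder.
Context (a : ordinal_rep).
Implicit Types x y z : a.

Lemma ord_total x y : ord_le x y || ord_le y x.
Proof.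
exact: (@wochoice.wo_chainW {classic a} _ predT (fun A _ => @ord_wo a A)).
Qed.

Lemma ord_refl x : ord_le x x.
Proof. by have := ord_total x x; rewrite orbb. Qed.

Lemma ord_anti x y : ord_le x y -> ord_le y x -> x = y.
Proof.
move=> xy yx; have := @wochoice.wo_chain_antisymmetric {classic a} _ predT
  (fun A _ => @ord_wo a A); apply=> //; exact/andP.
Qed.

Lemma ord_min (A : set a) : A !=set0 ->
  exists m, A m /\ forall z, A z -> ord_le m z.
Proof.
case=> x Ax; have [|m [[Am mmin] _]] := @ord_wo a (mem A).
  by exists x; apply: mem_set.
by exists m; split=> [|z Az]; [exact: set_mem|exact/mmin/mem_set].
Qed.

Lemma ord_ltP x y : reflect (ord_le x y /\ x <> y) (ord_lt x y).
Proof.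
by apply: (iffP andP) => -[xy nxy]; split=> //; apply/(@eqP {classic a}).
Qed.

Lemma ord_ltNge x y : ord_lt x y <-> ~ ord_le y x.
Proof.
split=> [/ord_ltP[xy nxy] yx|nyx]; first exact/nxy/ord_anti.
have /orP[xy|//] := ord_total x y; apply/ord_ltP; split=> // Exy.
by apply: nyx; rewrite Exy ord_refl.
Qed.

Lemma ord_trans y x z : ord_le x y -> ord_le y z -> ord_le x z.
Proof.
move=> xy yz; have [|m [Am mmin]] := @ord_min [set x; y; z].
  by exists x; left; left.
case: Am mmin => [[->|->]|->] mmin.
- by apply: mmin; right.
- by rewrite (ord_anti xy) //; apply: mmin; left; left.
- by rewrite -(ord_anti yz) //; apply: mmin; left; right.
Qed.

Lemma ord_lt_wf : well_founded (@ord_lt a).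
Proof.
move=> x; apply: contrapT => nacc.
have [m [nm mmin]] :=
  @ord_min [set x | ~ Acc (@ord_lt a) x] (ex_intro _ x nacc).
apply: nm; constructor => y /ord_ltNge nmy.
by apply: contrapT => /mmin; apply: nmy.
Qed.

End WellOrder.

(** A well-order [c] which no proper initial segment of [a] can cover is long
    enough to contain a copy of [a] as an initial segment. *)
Lemma initial_segment_embedding (a c : ordinal_rep) :
    (forall x : a, ~ ([set: c] #<= [set y | ord_lt y x])) -> ordinal_le a c.
Proof.
move=> small.
(* The embedding sends [x] to the least element of [c] not yet attained. *)
have least (x : a) (rec : forall y, ord_lt y x -> c) : exists m : c,
    (forall y (h : ord_lt y x), rec y h <> m) /\
    forall z, (forall y (h : ord_lt y x), rec y h <> z) -> ord_le m z.
  apply: ord_min; apply: contrapT => full; apply: (small x).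
  have /choice[g gP] z : exists y, exists h : ord_lt y x, rec y h = z.
    apply: contrapT => noy; apply: full; exists z => y h Ez.
    by apply: noy; exists y, h.
  have ginj : {in [set: c] &, injective g}.
    move=> u v _ _ Eg; have [hu <-] := gP u; have [hv <-] := gP v.
    by case: _ / Eg hv => hv; rewrite (bool_irrelevance hu hv).
  have /card_eqPle[_ le_cg] := inj_card_eq ginj.
  by apply: card_le_trans le_cg (subset_card_le _) => _ [z _ <-]; case: (gP z).
pose step x rec := sval (cid (least x rec)).
pose f := Fix (@ord_lt_wf a) (fun=> c) step.
have fE x : f x = step x (fun y _ => f y).
  apply: (@Fix_eq _ _ (@ord_lt_wf a) (fun=> c) step) => {}x g h Egh.
  congr (step x _).
  by apply: functional_extensionality_dep => y; apply: funext => ?; apply: Egh.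
have f_new x y : ord_lt y x -> f y <> f x.
  move=> ltyx; rewrite [f x]fE /step; case: cid => m /= [mnew _].
  exact: (mnew y ltyx).
have f_min x z : (forall y, ord_lt y x -> f y <> z) -> ord_le (f x) z.
  by move=> znew; rewrite fE /step; case: cid => m /= [_]; apply.
have f_lt x y : ord_lt y x -> ord_lt (f y) (f x).
  move=> ltyx; apply/ord_ltP; split; last exact: f_new.
  apply: f_min => w /ord_ltP[le_wy _]; apply: f_new; apply/ord_ltNge => le_xw.
  by move/ord_ltNge: ltyx; apply; apply: ord_trans le_xw le_wy.
exists f; split=> [x y|x z le_zx].
  apply/idP/idP => [|le_xy].
    by apply: contraTT => /negP/ord_ltNge/f_lt/ord_ltNge/negP.
  have [->|nxy] := pselect (x = y); first exact: ord_refl.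
  have /ord_ltP[] // : ord_lt (f x) (f y).
  by apply: f_lt; apply/ord_ltP.
have [->|nz] := pselect (z = f x); first by exists x.
apply: contrapT => noy.
have /ord_ltNge : ord_lt z (f x) by apply/ord_ltP.
by apply; apply: f_min => y _ Ez; apply: noy; exists y.
Qed.

(** * Lower bound *)

Lemma cf_star_lower_bound (b c : ordinal_rep) (G : c -> set sym_nat) :
  is_bounding_number b -> cf_star_chain G -> ordinal_le b c.
Proof.
move=> bP [Gproper _ _ Gcof]; apply: initial_segment_embedding => i le_ci.
have /choice[p pG] j : exists p, ~ G j p.
  apply: contrapT => noj; have [_] := Gproper j; apply.
  rewrite predeqE => q; split=> // _; apply: contrapT => nGq.
  by apply: noj; exists q.
have small : ~ ([set: b] #<= [set: c]).
  have [/(_ i)/andP[_ /negP lt_ib] _ _] := bP.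
  by move=> le_bc; apply: lt_ib; apply: card_le_trans le_bc le_ci.
(* [f] dominates all the [p j] and their inverses. *)
have [f finc fP] :=
  small_family_bounded (fun j n => maxn (p j n) ((p j)^-1%g n)) bP small.
have [j /(_ (p j)) Sj] := Gcof f finc.
apply: (pG j); apply: Sj; apply: sub_gen_smallest; split;
  (apply: le_star_trans (fP j I); apply/le_starP; exists 0 => n _).
  exact: leq_maxl.
exact: leq_maxr.
Qed.

(** * Permutations bounded modulo an ultrafilter *)

Lemma ultrafilter_tail (L : set_system nat) N :
  UltraFilter L -> non_principal L -> L [set n | (N <= n)%N].
Proof.
move=> LU Lnp; have Lpt x : L (~` [set x]).
  have [Lx|//] := in_ultra_setVsetC [set x] LU.
  have [] := Lnp [set x]; rewrite predeqE => U; split=> [LU'|xU].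
    have [y [Uy /= Ey]] := filter_ex (filterI LU' Lx).
    by move=> _ ->; rewrite -Ey.
  by apply: filterS Lx.
elim: N => [|N IHN]; first by apply: filterS filterT.
apply: filterS (filterI IHN (Lpt N)) => n /= [leNn nN].
by rewrite ltn_neqAle leNn andbT; apply/eqP => EN; apply: nN.
Qed.

(** [b]-many sets of a pseudo-P-point have an infinite pseudo-intersection. *)
Lemma pseudo_intersection (b bplus : ordinal_rep) L (D : b -> set nat) :
    is_successor_cardinal b bplus -> pseudo_P_point bplus L ->
    (forall i, L (D i)) ->
  exists2 A, infinite_set A & forall i, almost_subset A (D i).
Proof.
move=> [_ /andP[le_bbp /negP lt_bbp] _] [_ _ Lpi] LD.
have le_D : range D #<= [set: b] by apply: card_image_le.
have [|| A [Ainf AD]] := Lpi (range D).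
- by move=> _ [i _ <-].
- apply/andP; split; first exact: card_le_trans le_D le_bbp.
  by apply/negP => le_bpD; apply: lt_bbp; apply: card_le_trans le_bpD le_D.
- by exists A => // i; apply: AD; exists i.
Qed.

(** An unbounded family indexed by [b] is cofinal modulo the ultrafilter. *)
Lemma dominating_mod_ultrafilter (b bplus : ordinal_rep) L
    (x : b -> nat -> nat) :
    is_successor_cardinal b bplus -> pseudo_P_point bplus L ->
    (forall i, increasing (x i)) -> (~ exists g, forall i, le_star (x i) g) ->
  forall f, exists i, L [set n | (f n <= x i n)%N].
Proof.
move=> bbp LP xinc xunb f; apply: contrapT => nof; apply: xunb.
have [|A Ainf Ax] := @pseudo_intersection b bplus L
    (fun i => [set n | (x i n < f n)%N]) bbp LP.
  move=> i; case: (LP) => LU _ _.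
  have [Li|] := in_ultra_setVsetC [set n | (f n <= x i n)%N] LU.
    by case: nof; exists i.
  by apply: filterS => n /= /negP; rewrite -ltnNge.
have [nxt nxtP] := choice (fun n => infinite_ge n Ainf).
(* As [x i] is increasing, its value at [n] is at most its value at the point
   [nxt n] of [A], where [f] is eventually larger. *)
exists (f \o nxt) => i; have /almost_subsetP[N AN] := Ax i.
apply/le_starP; exists N => n leNn; have [An le_n] := nxtP n.
apply: leq_trans (increasing_le (xinc i) le_n) (ltnW (AN _ _ An)).
exact: leq_trans le_n.
Qed.

(** The points [n] such that [p] and its inverse map [[0, n]] into
    [[0, x n]]. *)
Definition bounded_at (x : nat -> nat) (p : sym_nat) : set nat :=
  [set n | forall k, (k <= n)%N -> (p k <= x n)%N /\ ((p^-1)%g k <= x n)%N].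

(** A pointwise bound by an increasing function eventually bounds whole initial
    segments. *)
Lemma bounded_at_dominated f (p : sym_nat) : increasing f ->
  le_star p f -> le_star (p^-1)%g f ->
  exists N, forall n, (N <= n)%N -> bounded_at f p n.
Proof.
move=> finc /le_starP[N pf] /le_starP[M pVf].
(* Below [maxn N M] the values of [p] and its inverse may exceed [f], so [n] is
   also taken above all of them. *)
exists (maxn (maxn N M) (\max_(k < maxn N M) maxn (p k) ((p^-1)%g k))) => n.
rewrite geq_max => /andP[_ ltn] k lekn.
have [leNk|ltkN] := leqP (maxn N M) k.
  move: leNk; rewrite geq_max => /andP[leN leM].
  by split; [apply: leq_trans (pf _ leN) _|apply: leq_trans (pVf _ leM) _];
    apply: increasing_le.
have := leq_trans (leq_bigmax (Ordinal ltkN)) ltn.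
rewrite geq_max => /andP[/= pk pVk]; have le_nf := increasing_ge n finc.
by split; [apply: leq_trans pk _|apply: leq_trans pVk _].
Qed.

(** The permutations bounded by [x] modulo [L]; composition need not preserve
    them, since a bound at [n] says nothing about the values at [x n]. *)
Definition bounded_mod (L : set_system nat) (x : nat -> nat) : set sym_nat :=
  [set p | L (bounded_at x p)].

(** Each permutation [p] generated by those bounded by [z] modulo [L] comes with
    a set [D] of [L] deciding where it lies: for an infinite [A] almost included
    in [D], [p] belongs to [S_ y] as soon as, for every [n], [y n] bounds the
    value of [z] at some point of [A] not below [n]. The function [y] depends on
    [A] and [z] but not on [p]. *)
Lemma pseudo_intersection_S L z (p : sym_nat) : Filter L ->
    smallest is_subgroup (bounded_mod L z) p ->
  exists2 D, L D & forall A y,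
    (forall n, exists m, [/\ A m, (n <= m)%N & (z m <= y n)%N]) ->
    almost_subset A D -> S_ y p.
Proof.
move=> LF; pose H := [set q : sym_nat | exists2 D, L D & forall A y,
    (forall n, exists m, [/\ A m, (n <= m)%N & (z m <= y n)%N]) ->
    almost_subset A D -> S_ y q].
apply: (@smallest_sub _ is_subgroup _ H) => [|q Lq].
  apply/is_subgroupP; split=> [|q r [D LD qD] [E LE rE]].
    exists setT => [|A y _ _]; first exact: filterT.
    by have /is_subgroupP[] := is_subgroup_smallest
      [set p : sym_nat | le_star p y /\ le_star (p^-1)%g y].
  exists (D `&` E) => [|A y yA /almost_subsetP[N AN]]; first exact: filterI.
  have /is_subgroupP[_] := is_subgroup_smallest
    [set p : sym_nat | le_star p y /\ le_star (p^-1)%g y]; apply.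
    by apply: (qD A) => //; apply/almost_subsetP; exists N => n leNn /AN[].
  by apply: (rE A) => //; apply/almost_subsetP; exists N => n leNn /AN[].
exists (bounded_at z q) => // A y yA /almost_subsetP[N AN].
by apply: sub_gen_smallest; split; apply/le_starP; exists N => n leNn;
  have [m [Am le_nm zy]] := yA n;
  have [qn qVn] := AN m (leq_trans leNn le_nm) Am n le_nm;
  [apply: leq_trans qn _|apply: leq_trans qVn _].
Qed.

(** * The chain of length b *)

Lemma bounded_mod_proper (b bplus : ordinal_rep) L z :
    is_bounding_number b -> is_successor_cardinal b bplus ->
    pseudo_P_point bplus L ->
  smallest is_subgroup (bounded_mod L z) <> [set: sym_nat].
Proof.
move=> bP bbp LP full; case: (LP) => LU _ _.
have [x [xinc /(unbounded_sym_nat xinc)[p]]] := unbounded_family bP; apply.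
have /choice[D DP] i : exists D, L D /\ forall A y,
    (forall n, exists m, [/\ A m, (n <= m)%N & (z m <= y n)%N]) ->
    almost_subset A D -> S_ y (p i).
  have [|D LD DP] := @pseudo_intersection_S L z (p i) _; first by rewrite full.
  by exists D.
have [A Ainf AD] := pseudo_intersection bbp LP (fun i => proj1 (DP i)).
have [nxt nxtP] := choice (fun n => infinite_ge n Ainf).
have [w wP] := S_bounded (majorant_increasing (z \o nxt)).
exists w => i; apply: wP; apply: (proj2 (DP i)) (AD i) => n.
have [An le_n] := nxtP n.
by exists (nxt n); split=> //; apply: (le_majorant (z \o nxt)).
Qed.

Lemma cf_star_chain_bounding (b bplus : ordinal_rep) L :
    is_bounding_number b -> is_successor_cardinal b bplus ->
    pseudo_P_point bplus L ->
  exists G : b -> set sym_nat, cf_star_chain G.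
Proof.
move=> bP bbp LP; have [x [xinc xunb]] := unbounded_family bP.
have xdom := dominating_mod_ultrafilter bbp LP xinc xunb.
case: (LP) => LU Lnp _.
pose P i := \bigcup_(j in [set j | ord_le j i]) bounded_mod L (x j).
exists (fun i => smallest is_subgroup (P i)); split=> [i|i j le_ij||f finc].
- split; first exact: is_subgroup_smallest.
  (* The functions [x j] with [j] at most [i] have a common bound [z]. *)
  have small : ~ ([set: b] #<= [set j | ord_lt j i]).
    by have [/(_ i)/andP[_ /negP]] := bP.
  have [g ginc gP] := small_family_bounded x bP small.
  pose z n := maxn (g n) (x i n).
  have sub : P i `<=` bounded_mod L z.
    move=> p [j /= le_ji Lp].
    have /le_starP[N xz] : le_star (x j) z.
      have [->|nji] := pselect (j = i).
        by apply/le_starP; exists 0 => n _; apply: leq_maxr.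
      apply: (@le_star_trans g); first by apply: gP; apply/ord_ltP.
      by apply/le_starP; exists 0 => n _; apply: leq_maxl.
    apply: filterS (filterI Lp (ultrafilter_tail N LU Lnp)) => n [px /xz xzn] k.
    move=> /px[pk pVk].
    by split; [apply: leq_trans pk _|apply: leq_trans pVk _].
  move=> full; apply: (@bounded_mod_proper b bplus L z) => //.
  rewrite -subTset -full; apply: smallest_sub.
    exact: is_subgroup_smallest.
  exact: sub_smallest.
- apply: sub_smallest2r; first exact: is_subgroup_smallest.
  by move=> p [k le_ki Lp]; exists k => //; apply: ord_trans le_ki le_ij.
- rewrite -subTset => p _.
  have [i Li] := xdom (majorant (fun n => maxn (p n) ((p^-1)%g n))).
  exists i => //; apply: sub_gen_smallest; exists i; first exact: ord_refl.
  apply: filterS Li => n /= xn k lekn.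
  have := leq_trans (increasing_le (majorant_increasing _) lekn) xn.
  move/(leq_trans (le_majorant _ _)).
  by rewrite geq_max => /andP[].
- have [i Li] := xdom f; exists i; apply: sub_smallest2r.
    exact: is_subgroup_smallest.
  move=> p [pf pVf]; exists i; first exact: ord_refl.
  have [N pN] := bounded_at_dominated finc pf pVf.
  apply: filterS (filterI Li (ultrafilter_tail N LU Lnp)) => n [fx /pN pn] k.
  by move=> /pn[pk pVk]; split; [apply: leq_trans pk _|apply: leq_trans pVk _].
Qed.

Theorem corollary1p8 (b bplus : ordinal_rep) :
  is_bounding_number b ->
  is_successor_cardinal b bplus ->
  (exists L : set_system nat, pseudo_P_point bplus L) ->
  is_cf_star b.
Proof.
move=> bP bbp [L LP]; split; first exact: cf_star_chain_bounding bP bbp LP.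
by move=> c G; apply: cf_star_lower_bound.
Qed.
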